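(* Suppose $M$ is analytic in $\lambda\in\rho\bar{\mathbb{D}}$, with $M(0)$ invertible, and let $\mathbf{A}^*$ be the conjugate transpose of the infinite matrix $\mathbf{A}=\mathbf{e}_1\otimes\mathbf{N}+\mathbf{S}\otimes I$ associated with $M$, with domain $\mathcal{D}(\mathbf{A}^* )=\ell_1(\rho)$ (see context). (i) If $(\mu,\mathbf{w})\in\mathbb{C}\times(\mathcal{D}(\mathbf{A}^* )\setminus\{0\})$ is an eigenpair of $\mathbf{A}^*$ and $\lambda=\mu^{-1}\in\rho\mathbb{D}$, then there exists a vector $z\in\mathbb{C}^n$ such that $$\mathbf{w}=\sum_{j=1}^\infty(\mathbf{S}^T\otimes I)^{j-1}\mathbf{N}^*\lambda^j z .$$ (ii) The pair $(\lambda,y)\in(\rho\mathbb{D}\setminus\{0\})\times(\mathbb{C}^n\setminus\{0\})$ is a solution to $M(\lambda)^*y=0$ if and only if the pair $(\lambda^{-1},\mathbf{w})\in(\mathbb{C}\setminus\rho^{-1}\bar{\mathbb{D}})\times\mathcal{D}(\mathbf{A}^* )$ is an eigenpair of $\mathbf{A}^*$, where $$\mathbf{w}=\sum_{j=1}^\infty(\mathbf{S}^T\otimes I)^{j-1}\mathbf{N}^*\lambda^j z\quad\text{with } z=M(0)^*y .$$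
   Context: $\rho>0$ is a constant, $\mathbb{D}$ is the open unit disk in $\mathbb{C}$ and $\bar{\mathbb{D}}$ its closure. $M:\mathbb{C}\to\mathbb{C}^{n\times n}$ is a matrix depending on a parameter, whose elements are analytic in $\rho\bar{\mathbb{D}}$. It is assumed throughout that $0$ is not an eigenvalue of $M$, i.e. $M(0)^{-1}$ exists. $^*$ denotes conjugate transpose; $M(\lambda)^*$ is the conjugate transpose of the matrix $M(\lambda)$. For $j\ge1$ put $N_j=-\tfrac1j M(0)^{-1}M^{(j)}(0)\in\mathbb{C}^{n\times n}$ and $\mathbf{N}=[N_1\ N_2\ N_3\ \cdots]\in\mathbb{C}^{n\times\infty}$, so $\mathbf{N}^*$ has block rows $N_1^*,N_2^*,\dots$. $\mathbf{e}_1=[1\ 0\ 0\ \cdots]^T$ is the first unit vector of infinite length, $I$ is the $n\times n$ identity, and $\mathbf{S}$ is the infinite matrix with entries $1/j$ in position $(j+1,j)$, $j\ge1$, and zeros elsewhere. Vectors of infinite length are written in blocks $\mathbf{w}=[w_j]_{j=1}^\infty$ with $w_j\in\mathbb{C}^n$. The conjugate transpose is $\mathbf{A}^*=\mathbf{e}_1^T\otimes\mathbf{N}^*+\mathbf{S}^T\otimes I$; thus the $k$-th block of $\mathbf{A}^*\mathbf{w}$ is $N_k^*w_1+\tfrac1k w_{k+1}$, and the $k$-th block of $(\mathbf{S}^T\otimes I)\mathbf{w}$ is $\tfrac1k w_{k+1}$, for $k\ge1$. With $\|\cdot\|$ the 2-norm, $\ell_1(\rho)=\{\mathbf{w}=[w_j]_{j=1}^\infty\in\mathbb{C}^\infty:\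 \sum_{j=1}^\infty\tfrac{\rho^j}{j!}\|w_j\|<\infty\}$. An eigenpair $(\mu,\mathbf{w})$ of $\mathbf{A}^*$ consists of $\mu\in\mathbb{C}$ and a nonzero $\mathbf{w}\in\mathcal{D}(\mathbf{A}^* )=\ell_1(\rho)$ with $\mathbf{A}^*\mathbf{w}=\mu\mathbf{w}$.
   Formalization: In (ii), M(λ)^*y=0 is replaced by M(conj λ)^*y=0; the equivalence is stated as: w is an eigenvector iff it is the series for some nonzero solution y, and for a fixed y only if the N_k^* have trivial common kernel. The printed (ii) is false (e.g. M(λ)=λ−i; M=diag(1,1−λ)). *)

(* Defs.v *)
From mathcomp Require Import all_boot all_order all_algebra.
From mathcomp Require Import all_classical all_reals all_analysis.
From mathcomp Require Import complex spectral sesquilinear.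

Set Implicit Arguments.
Unset Strict Implicit.
Unset Printing Implicit Defensive.

Import Order.TTheory GRing.Theory Num.Theory.
Import numFieldNormedType.Exports.

Local Open Scope classical_set_scope.
Local Open Scope ring_scope.
Local Open Scope complex_scope.
Local Open Scope sesquilinear_scope.

(* The cast gives R[i] the topology that MathComp-Analysis attaches to every
   numFieldType; R[i] itself only gets it through the alias R[i]^o. *)
Definition Cplx (R : realType) : numClosedFieldType := R[i].

Definition analytic_at (R : realType) (f : Cplx R -> Cplx R) (a : Cplx R) :=
  exists c : nat -> Cplx R, exists2 r : R, 0 < r &
    forall z : Cplx R, `|z - a| < r%:C ->
      series (fun k => c k * (z - a) ^+ k) @ \oo --> f z.

(* Analyticity at each point of the closed disk of radius rho; as usual this
   entails analyticity on a neighbourhood of that disk. *)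
Definition analytic_on_closed_disk (R : realType) (n : nat) (rho : R)
    (M : Cplx R -> 'M[Cplx R]_n) :=
  forall (i k : 'I_n) (a : Cplx R), `|a| <= rho%:C ->
    analytic_at (fun z => M z i k) a.

(* M^(j)(a), entrywise j-th complex derivative. *)
Definition mx_derive (R : realType) (n : nat) (M : Cplx R -> 'M[Cplx R]_n)
    (j : nat) (a : Cplx R) : 'M[Cplx R]_n :=
  \matrix_(i, k) derive1n j (fun z => M z i k) a.

(* N_j = - (1/j) M(0)^-1 M^(j)(0), meaningful for j >= 1. *)
Definition Nmx (R : realType) (n : nat) (M : Cplx R -> 'M[Cplx R]_n)
    (j : nat) : 'M[Cplx R]_n :=
  - (j%:R^-1 *: (invmx (M 0) *m mx_derive M j 0)).

(* Blocks are numbered from 0: if w encodes [w_j]_(j >= 1), then w k is the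
   block w_(k+1). *)
Definition blocks (R : realType) (n : nat) := nat -> 'cV[Cplx R]_n.

(* N^* z, with k-th block (k >= 1) N_k^* z. *)
Definition Nstar (R : realType) (n : nat) (M : Cplx R -> 'M[Cplx R]_n)
    (z : 'cV[Cplx R]_n) : blocks R n :=
  fun k => (Nmx M k.+1)^t* *m z.

(* (S^T (x) I) w, with k-th block (k >= 1) (1/k) w_(k+1). *)
Definition STI (R : realType) (n : nat) (w : blocks R n) : blocks R n :=
  fun k => k.+1%:R^-1 *: w k.+1.

(* A^* w = (e_1^T (x) N^* + S^T (x) I) w. *)
Definition Astar (R : realType) (n : nat) (M : Cplx R -> 'M[Cplx R]_n)
    (w : blocks R n) : blocks R n :=
  fun k => Nstar M (w 0%N) k + STI w k.

Definition norm2 (R : realType) (n : nat) (v : 'cV[Cplx R]_n) : R :=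
  Num.sqrt (\sum_i (complex.Re (v i 0) ^+ 2 + complex.Im (v i 0) ^+ 2)).

Definition in_ell1 (R : realType) (n : nat) (rho : R) (w : blocks R n) : Prop :=
  cvgn (series (fun k => rho ^+ k.+1 / (k.+1)`!%:R * norm2 (w k))).

Definition eigenpair_Astar (R : realType) (n : nat) (rho : R)
    (M : Cplx R -> 'M[Cplx R]_n) (mu : Cplx R) (w : blocks R n) : Prop :=
  [/\ in_ell1 rho w, exists k, w k != 0 & forall k, Astar M w k = mu *: w k].

(* w = sum_(j >= 1) (S^T (x) I)^(j-1) N^* lambda^j z, an identity between
   elements of (C^n)^oo: the series converges to w block by block. *)
Definition left_series (R : realType) (n : nat) (M : Cplx R -> 'M[Cplx R]_n)
    (lambda : Cplx R) (z : 'cV[Cplx R]_n) (w : blocks R n) : Prop :=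
  forall k, series (fun j =>
    iter j (@STI R n) (Nstar M (lambda ^+ j.+1 *: z)) k) @ \oo --> w k.

(* sum_j lambda^j / j! (M^(j)(0))^* y = 0: the stars fall on the coefficients
   only, as they do in A^*, where lambda is not conjugated. The sum is the
   conjugate transpose of M at the conjugate of lambda; with M(lambda)
   conjugate-transposed instead, eigenpairs of A^* and solutions need not
   match when lambda is not real. *)
Definition dual_solution (R : realType) (n : nat) (M : Cplx R -> 'M[Cplx R]_n)
    (lambda : Cplx R) (y : 'cV[Cplx R]_n) : Prop :=
  (M lambda^*)^t* *m y = 0.

(* Main.v *)
Require Import Defs.
From mathcomp Require Import all_boot all_order all_algebra.
From mathcomp Require Import all_classical all_reals all_analysis.
From mathcomp Require Import complex spectral sesquilinear ring lra.
From mathcomp Require Import cyclic separable cyclotomic.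

Set Implicit Arguments.
Unset Strict Implicit.
Unset Printing Implicit Defensive.

Import Order.TTheory GRing.Theory Num.Theory.
Import numFieldNormedType.Exports.

Local Open Scope classical_set_scope.
Local Open Scope ring_scope.
Local Open Scope complex_scope.
Local Open Scope sesquilinear_scope.

(** Write [C_m = M^(m)(0) / m!], so that [N_m = - (m-1)! M(0)^-1 C_m] and
    [N_m^* z = - (m-1)! C_m^* y] when [z = M(0)^* y].  The [k]-th block, counted
    from 0, of the series of the theorem is then
      [w_k = - k! \sum_j lambda^(j+1) C_(k+j+1)^* y],
    which is [dual_blocks].  Splitting off its first term gives
    [w = lambda (N^* z + (S^T (x) I) w)] ([dual_blocks_rec]), and for [k = 0] the
    sum is the adjoint Taylor series without its constant term:
    [w_0 = z - L y] with [L = M(conj lambda)^*] ([dual_blocks0]).  Comparing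
    with [A^* w = N^* w_0 + (S^T (x) I) w], the equation [A^* w = lambda^-1 w]
    amounts to [N^* (L y) = 0] ([dual_blocks_eigenP]).  It holds if [L y = 0],
    and conversely forces [L y = 0] when [N^*] is injective.

    In the other direction an eigenvector satisfies
    [w = lambda (N^* w_0 + (S^T (x) I) w)].  Iterating this [J] times produces [J]
    terms of the series with [z = w_0] and a remainder whose [k]-th block
    [lambda^J k! / (k+J)! w_(k+J)] tends to 0 because [w] is in [ell_1(rho)] and
    [|lambda| < rho] ([eigen_left_series]).  So [w] is the series for the [y]
    with [M(0)^* y = w_0], and its block 0 shows that [L y = 0].

    That the series lies in [ell_1(rho)] needs the coefficients [C_m] to decay
    like [s^-m] for some [s > rho], and the formula for [w_0] needs the Taylor
    series of [M] at 0 to sum to [M] on the disk of radius [rho].  The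
    hypothesis only provides a local expansion at each point of the closed
    disk, and [taylor_series_of_analytic] derives these facts from it without
    contour integrals.  By compactness there is one [D] such that, at every
    point [a] of the closed disk, the expansion of [f] converges to [f] within
    distance [1/D] and has [k]-th coefficient at most [D^(k+1)]
    ([taylor_bound_uniform]).  Suppose that the Taylor series [\sum c_n z^n] at 0
    sums to [f] for [|z| < r], where [r <= rho], and let [s < r].  Cauchy's
    estimates for [f^(k) / k!] on the circle of radius [s], which follow by
    averaging over roots of unity, give [binomial(n,k) |c_n| s^(n-k) <= D^(k+1)].
    Multiplied by [(2D)^-k] and summed over [k], these yield
    [|c_n| (s + 1/(2D))^n <= 2D] ([taylor_coef_bound]).  The series therefore
    converges on a disk larger by a fixed amount, and it still sums to [f] there,
    as re-expanding it at points close to the circle shows ([ps_on_extend]).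
    Finitely many such steps lead beyond [rho].  Rearrangements of double series
    rest on Tannery's theorem ([tannery]). *)

(** * Modulus and convergence in the complex numbers *)

Section Modulus.
Variable R : realType.
Local Notation C := (Cplx R).
Implicit Types x y z : C.

(** The norm of [R[i]] takes its values in [R[i]], whose order is only partial;
    [cabs] is the same modulus in the totally ordered field [R]. *)
Definition cabs (z : C) : R := complex.Re `|z|.

Lemma cabsE z : `|z| = (cabs z)%:C.
Proof. by rewrite /cabs normc_def. Qed.

Lemma cabs_ge0 z : 0 <= cabs z.
Proof. by rewrite -lecR -cabsE normr_ge0. Qed.

Lemma cabs0 : cabs 0 = 0.
Proof. by apply: complexI; rewrite -cabsE normr0. Qed.

Lemma cabs1 : cabs 1 = 1.
Proof. by apply: complexI; rewrite -cabsE normr1. Qed.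

Lemma cabsN z : cabs (- z) = cabs z.
Proof. by apply: complexI; rewrite -!cabsE normrN. Qed.

Lemma cabsB x y : cabs (x - y) = cabs (y - x).
Proof. by rewrite -cabsN opprB. Qed.

Lemma cabsM x y : cabs (x * y) = cabs x * cabs y.
Proof. by apply: complexI; rewrite rmorphM /= -!cabsE normrM. Qed.

Lemma cabsX z n : cabs (z ^+ n) = cabs z ^+ n.
Proof. by elim: n => [|n IH]; rewrite ?expr0 ?cabs1 // !exprS cabsM IH. Qed.

Lemma cabsV z : cabs z^-1 = (cabs z)^-1.
Proof. by apply: complexI; rewrite fmorphV /= -!cabsE normfV. Qed.

Lemma cabs_nat n : cabs n%:R = n%:R.
Proof. by apply: complexI; rewrite rmorph_nat -cabsE normr_nat. Qed.

Lemma cabs_real (a : R) : 0 <= a -> cabs a%:C = a.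
Proof. by move=> a0; apply: complexI; rewrite -cabsE ger0_norm // lecR. Qed.

Lemma cabs_eq0 z : (cabs z == 0) = (z == 0).
Proof. by rewrite -[RHS]normr_eq0 cabsE -(inj_eq (@complexI R)). Qed.

Lemma cabsD x y : cabs (x + y) <= cabs x + cabs y.
Proof. by rewrite -lecR rmorphD /= -!cabsE ler_normD. Qed.

Lemma cabs_tri z x y : cabs (x - y) <= cabs (x - z) + cabs (z - y).
Proof. by have := cabsD (x - z) (z - y); rewrite addrA subrK. Qed.

Lemma cabs_sum (I : Type) (r : seq I) (P : pred I) (F : I -> C) :
  cabs (\sum_(i <- r | P i) F i) <= \sum_(i <- r | P i) cabs (F i).
Proof.
elim/big_ind2: _ => [|x1 x2 y1 y2 h1 h2|//]; first by rewrite cabs0.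
by apply: le_trans (cabsD _ _) _; rewrite lerD.
Qed.

Lemma cabs_Re z : `|complex.Re z| <= cabs z.
Proof. by rewrite -lecR -cabsE normc_ge_Re. Qed.

Lemma cabs_ReIm z : cabs z <= `|complex.Re z| + `|complex.Im z|.
Proof.
rewrite /cabs normc_def /= -(@ler_pXn2r _ 2) ?nnegrE ?sqrtr_ge0 ?addr_ge0 //.
rewrite sqr_sqrtr ?addr_ge0 ?sqr_ge0 // sqrrD !real_normK ?num_real //.
have := mulr_ge0 (normr_ge0 (complex.Re z)) (normr_ge0 (complex.Im z)); lra.
Qed.

Lemma cabs_Im z : `|complex.Im z| <= cabs z.
Proof.
rewrite /cabs normc_def /= -(@ler_pXn2r _ 2) ?nnegrE ?sqrtr_ge0 //.
rewrite sqr_sqrtr ?addr_ge0 ?sqr_ge0 // real_normK ?num_real //.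
by rewrite lerDr sqr_ge0.
Qed.

Lemma cvgcP (u : nat -> C) (l : C) :
  u @ \oo --> l <->
  forall e : R, 0 < e -> exists N, forall n, (N <= n)%N -> cabs (u n - l) < e.
Proof.
split=> [/cvgrPdist_lt h e e0|h].
  have [|N _ hN] := h e%:C; first by rewrite ltcR.
  exists N => n Nn; have := hN n Nn.
  by rewrite /= cabsE ltcR cabsB.
apply/cvgrPdist_lt => e e0.
have eR : e = (complex.Re e)%:C by rewrite RRe_real // gtr0_real.
have [|N hN] := h (complex.Re e); first by rewrite -ltcR -eR.
by exists N => // n Nn; rewrite /= eR cabsE ltcR cabsB; exact: hN.
Qed.

Lemma cvgc_le (u : nat -> C) (l a : C) (B : R) N :
  u @ \oo --> l -> (forall n, (N <= n)%N -> cabs (u n - a) <= B) ->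
  cabs (l - a) <= B.
Proof.
move=> /cvgcP h hB; apply/ler_addgt0Pl => e e0.
have [K hK] := h e e0; pose n := maxn N K.
apply: le_trans (cabs_tri (u n) _ _) _; apply: lerD; last exact/hB/leq_maxl.
by rewrite cabsB; apply/ltW/hK/leq_maxr.
Qed.

Lemma cvgc_unique (u : nat -> C) (l l' : C) :
  u @ \oo --> l -> u @ \oo --> l' -> l = l'.
Proof. by apply: cvg_unique; exact: norm_hausdorff. Qed.

Lemma cvgc_sum (I : Type) (r : seq I) (u : I -> nat -> C) (l : I -> C) :
  (forall i, u i @ \oo --> l i) ->
  (fun n => \sum_(i <- r) u i n) @ \oo --> \sum_(i <- r) l i.
Proof.
move=> h; elim: r => [|i r IH].
  rewrite big_nil (_ : (fun n => _) = cst 0); first exact: cvg_cst.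
  by apply/funext => n; rewrite big_nil.
rewrite big_cons (_ : (fun n => _) = (fun n => u i n + \sum_(j <- r) u j n)).
  exact: cvgD (h i) IH.
by apply/funext => n; rewrite big_cons.
Qed.

End Modulus.

(** * Series dominated by a geometric series *)

Section GeometricDomination.
Variable R : realType.
Local Notation C := (Cplx R).
Implicit Types (u : nat -> C) (A q : R).

Lemma cvgR0P (e : nat -> R) : e @ \oo --> (0 : R) ->
  forall d, 0 < d -> exists N, forall n, (N <= n)%N -> e n < d.
Proof.
move=> /cvgrPdist_lt h d d0; have [N _ hN] := h d d0; exists N => n Nn.
have := hN n Nn; rewrite /= sub0r normrN; apply: le_lt_trans; exact: ler_norm.
Qed.

Lemma geometric_small A q : 0 <= q < 1 ->
  forall d, 0 < d -> exists N, forall n, (N <= n)%N -> A * q ^+ n < d.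
Proof.
move=> /andP[q0 q1]; apply: cvgR0P; apply: cvg_geometric.
by rewrite ger0_norm.
Qed.

(** Telescoping: [A q^k] is the decrement of [A q^k / (1 - q)] at [k]. *)
Lemma geometric_series_tail u A q : 0 <= q < 1 ->
  (forall k, cabs (u k) <= A * q ^+ k) ->
  forall m n, (m <= n)%N ->
    cabs (series u n - series u m) <= A * q ^+ m / (1 - q).
Proof.
move=> /andP[q0 q1] hu m n mn.
have A0 : 0 <= A by have := hu 0; rewrite expr0 mulr1; apply: le_trans (cabs_ge0 _).
have d0 : 0 < 1 - q by rewrite subr_gt0.
suff : cabs (series u n - series u m) <= A * (q ^+ m - q ^+ n) / (1 - q).
  move/le_trans; apply; rewrite ler_pM2r ?invr_gt0 //.
  by apply: ler_wpM2l => //; rewrite lerBlDr lerDl exprn_ge0.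
elim: n mn => [|n IH].
  by rewrite leqn0 => /eqP->; rewrite !subrr cabs0 mulr0 mul0r.
rewrite leq_eqVlt => /orP[/eqP->|mn]; first by rewrite !subrr cabs0 mulr0 mul0r.
have -> : series u n.+1 - series u m = series u n - series u m + u n.
  by rewrite seriesSr addrAC.
apply: le_trans (cabsD _ _) _.
apply: le_trans (lerD (IH mn) (hu n)) _.
rewrite le_eqVlt; apply/orP; left; apply/eqP; rewrite exprS; field.
by rewrite gt_eqF.
Qed.

Definition csum u : C := limn (series u).

Lemma Re_series u n :
  complex.Re (series u n) = series (fun k => complex.Re (u k)) n.
Proof.
elim: n => [|n IH]; first by rewrite !seriesEnat /= !big_geq.
by rewrite !seriesSr -IH; case: (series u n) (u n) => [? ?] [? ?].
Qed.

Lemma Im_series u n :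
  complex.Im (series u n) = series (fun k => complex.Im (u k)) n.
Proof.
elim: n => [|n IH]; first by rewrite !seriesEnat /= !big_geq.
by rewrite !seriesSr -IH; case: (series u n) (u n) => [? ?] [? ?].
Qed.

Lemma cvgn_geometric_dominated (v : nat -> R) A q : 0 <= q < 1 ->
  (forall k, `|v k| <= A * q ^+ k) -> cvgn (series v).
Proof.
move=> /andP[q0 q1] hv; apply: normed_cvg.
apply: (@series_le_cvg _ _ (geometric A q)) => //.
- by move=> n /=.
- by move=> n; apply: le_trans (normr_ge0 _) (hv n).
- by apply: is_cvg_geometric_series; rewrite ger0_norm.
Qed.

(** Completeness is used on the real and imaginary parts, which are absolutely
    convergent real series. *)
Lemma csum_cvg u A q : 0 <= q < 1 ->
  (forall k, cabs (u k) <= A * q ^+ k) -> series u @ \oo --> csum u.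
Proof.
move=> hq hu.
have /cvg_ex[a ha] : cvgn (series (fun k => complex.Re (u k))).
  by apply: (cvgn_geometric_dominated hq) => k; apply: le_trans (cabs_Re _) (hu k).
have /cvg_ex[b hb] : cvgn (series (fun k => complex.Im (u k))).
  by apply: (cvgn_geometric_dominated hq) => k; apply: le_trans (cabs_Im _) (hu k).
suff h : series u @ \oo --> (a +i* b : C) by apply: cvgP h.
apply/cvgcP => e e0.
have e20 : 0 < e / 2 by rewrite divr_gt0.
have [N1 _ h1] := (cvgrPdist_lt _ _).1 ha _ e20.
have [N2 _ h2] := (cvgrPdist_lt _ _).1 hb _ e20.
exists (maxn N1 N2) => n; rewrite geq_max => /andP[n1 n2].
apply: le_lt_trans (cabs_ReIm _) _.
have := ltrD (h1 n n1) (h2 n n2); rewrite /= -splitr.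
apply: le_lt_trans.
rewrite [X in _ <= X + _]distrC [X in _ <= _ + X]distrC -Re_series -Im_series.
by case: (series u n).
Qed.

Lemma csumE u (l : C) : series u @ \oo --> l -> csum u = l.
Proof. by move=> h; apply: cvg_lim h; exact: norm_hausdorff. Qed.

Lemma csum_tail u A q m : 0 <= q < 1 ->
  (forall k, cabs (u k) <= A * q ^+ k) ->
  cabs (csum u - series u m) <= A * q ^+ m / (1 - q).
Proof.
move=> hq hu; apply: (cvgc_le (csum_cvg hq hu)) => n.
exact: geometric_series_tail.
Qed.

Lemma csum_le u A q : 0 <= q < 1 ->
  (forall k, cabs (u k) <= A * q ^+ k) -> cabs (csum u) <= A / (1 - q).
Proof.
move=> hq hu; have := csum_tail 0 hq hu.
by rewrite {1}/series /= big_geq // subr0 expr0 mulr1.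
Qed.

(** Tannery's theorem: the geometric bound makes all tails small uniformly in
    [N], which leaves finitely many terms to compare. *)
Lemma tannery (v : nat -> nat -> C) (d : nat -> C) A q : 0 <= q < 1 ->
  (forall N k, cabs (v N k) <= A * q ^+ k) ->
  (forall k, v^~ k @ \oo --> d k) ->
  (fun N => series (v N) N) @ \oo --> csum d.
Proof.
move=> hq hv hd.
have hdk k : cabs (d k) <= A * q ^+ k.
  rewrite -[d k]subr0; apply: (@cvgc_le _ _ _ _ _ 0 (hd k)) => n _.
  by rewrite subr0.
apply/cvgcP => e e0.
have e30 : 0 < e / 3 by rewrite divr_gt0.
have [K hK] := geometric_small (A / (1 - q)) hq e30.
have {}hK : A * q ^+ K / (1 - q) < e / 3 by rewrite mulrAC hK.
have hfin : (fun N => series (v N) K) @ \oo --> series d K.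
  exact: (@cvgc_sum _ _ _ (fun k => v^~ k)).
have [N1 hN1] := (cvgcP _ _).1 hfin _ e30.
exists (maxn N1 K) => N; rewrite geq_max => /andP[n1 nK].
have h1 := geometric_series_tail hq (hv N) nK.
have h2 := csum_tail K hq hdk.
have h3 := hN1 _ n1.
have h4 := cabs_tri (series (v N) K) (series (v N) N) (csum d).
have h5 := cabs_tri (series d K) (series (v N) K) (csum d).
rewrite (cabsB (series d K)) in h5; lra.
Qed.

End GeometricDomination.

(** * Power series and the derivatives of their sum *)

Section PowerSeries.
Variable R : realType.
Local Notation C := (Cplx R).
Implicit Types (c : nat -> C) (a b z : C) (f : C -> C) (A q r s t : R).

Lemma cvg_subn (w : nat -> C) (l : C) k :
  w @ \oo --> l -> (fun N => w (N - k)%N) @ \oo --> l.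
Proof.
by move=> h; apply: cvg_comp h; exact: cvg_subnr.
Qed.

Lemma binomial_term_le (x y : R) m k : 0 <= x -> 0 <= y ->
  'C(m + k, k)%:R * x ^+ m * y ^+ k <= (x + y) ^+ (m + k).
Proof.
move=> x0 y0; rewrite exprDn.
have hk : (k < (m + k).+1)%N by rewrite ltnS leq_addl.
rewrite (bigD1 (Ordinal hk)) //= addnK -mulrA mulr_natl lerDl.
by apply: sumr_ge0 => i _; rewrite mulrn_wge0 // mulr_ge0 ?exprn_ge0.
Qed.

(** The [k]-th coefficient of [\sum_n c n * x ^+ n] in powers of [x - a]. *)
Definition shift_coef c a (k : nat) : C :=
  csum (fun m => 'C(m + k, k)%:R * c (m + k)%N * a ^+ m).

Section Reexpansion.
Variables (c : nat -> C) (A s : R) (a : C) (t : R).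
Hypotheses (hc : forall m, cabs (c m) * s ^+ m <= A) (t0 : 0 < t)
  (hts : cabs a + t < s).

Let q := (cabs a + t) / s.

Let s0 : 0 < s.
Proof. by apply: le_lt_trans hts; rewrite addr_ge0 ?cabs_ge0 // ltW. Qed.

Let hq : 0 <= q < 1.
Proof.
by rewrite divr_ge0 ?addr_ge0 ?cabs_ge0 ?ltW //= ltr_pdivrMr // mul1r.
Qed.

Let A0 : 0 <= A.
Proof. by have := hc 0; rewrite expr0 mulr1; apply: le_trans (cabs_ge0 _). Qed.

Let term_le m k : cabs ('C(m + k, k)%:R * c (m + k)%N * a ^+ m) <=
  A / t ^+ k * q ^+ m.
Proof.
have tk0 : 0 < t ^+ k by rewrite exprn_gt0.
rewrite [leRHS]mulrAC ler_pdivlMr //.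
apply: (@le_trans _ _ (A * q ^+ (m + k))); last first.
  case/andP: hq => q0 q1; apply: ler_wpM2l => //.
  by rewrite exprD ler_piMr ?exprn_ge0 // exprn_ile1 // ltW.
rewrite !cabsM cabs_nat cabsX /q expr_div_n mulrA ler_pdivlMr ?exprn_gt0 //.
have h1 := binomial_term_le m k (cabs_ge0 a) (ltW t0).
have h2 : 'C(m + k, k)%:R * cabs a ^+ m * t ^+ k *
    (cabs (c (m + k)%N) * s ^+ (m + k)) <= (cabs a + t) ^+ (m + k) * A.
  apply: ler_pM => //; last by rewrite mulr_ge0 ?cabs_ge0 // exprn_ge0 // ltW.
  by rewrite !mulr_ge0 ?exprn_ge0 ?cabs_ge0 ?(ltW t0) ?ler0n.
rewrite [A * _]mulrC; apply: le_trans h2.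
by rewrite le_eqVlt; apply/orP; left; apply/eqP; ring.
Qed.

Lemma shift_coef_cvg k :
  series (fun m => 'C(m + k, k)%:R * c (m + k)%N * a ^+ m) @ \oo -->
  shift_coef c a k.
Proof. exact: csum_cvg hq (fun m => term_le m k). Qed.

Lemma shift_coef_le k :
  cabs (shift_coef c a k) * t ^+ k <= A / (1 - (cabs a + t) / s).
Proof.
rewrite -ler_pdivlMr ?exprn_gt0 // mulrAC.
exact: csum_le hq (fun m => term_le m k).
Qed.

(** By induction on [N]: every inner series gains one term, and the terms gained
    form the binomial expansion of [c N * (a + u) ^+ N]. *)
Lemma partial_sum_reexpansion (u : C) N :
  series (fun k => series (fun m => 'C(m + k, k)%:R * c (m + k)%N * a ^+ m)
                     (N - k)%N * u ^+ k) N =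
  series (fun n => c n * (a + u) ^+ n) N.
Proof.
elim: N => [|N IH]; first by rewrite /series /= !big_geq.
rewrite [RHS]seriesSr -IH /=.
pose g k : nat -> C := series (fun m => 'C(m + k, k)%:R * c (m + k)%N * a ^+ m).
have g0 k : g k 0 = 0 by rewrite /g /series /= big_geq.
have gS k n : g k n.+1 = g k n + 'C(n + k, k)%:R * c (n + k)%N * a ^+ n.
  by rewrite /g seriesSr.
change (\sum_(0 <= k < N.+1) g k (N.+1 - k)%N * u ^+ k =
        \sum_(0 <= k < N) g k (N - k)%N * u ^+ k + c N * (a + u) ^+ N).
have -> : \sum_(0 <= k < N) g k (N - k)%N * u ^+ k =
          \sum_(0 <= k < N.+1) g k (N - k)%N * u ^+ k.
  by rewrite big_nat_recr //= subnn g0 mul0r addr0.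
rewrite exprDn mulr_sumr -(big_mkord predT
  (fun i => c N * (a ^+ (N - i) * u ^+ i *+ 'C(N, i)))) -big_split /=.
apply: eq_big_nat => k /andP[_]; rewrite ltnS => kN.
rewrite subSn // gS mulrDl subnK //; congr (_ + _).
by rewrite -mulr_natl; ring.
Qed.

(** On partial sums the regrouping is the binomial formula, and the inner partial
    sums obey the bound of [shift_coef_le] uniformly: Tannery's theorem lets [N]
    tend to infinity. *)
Lemma reexpansion (u : C) : cabs u < t ->
  series (fun k => shift_coef c a k * u ^+ k) @ \oo -->
  csum (fun n => c n * (a + u) ^+ n).
Proof.
move=> ut.
have qu : 0 <= cabs u / t < 1.
  by rewrite divr_ge0 ?cabs_ge0 ?(ltW t0) //= ltr_pdivrMr // mul1r.
have bnd (x : C) k : cabs x * t ^+ k <= A / (1 - q) ->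
    cabs (x * u ^+ k) <= A / (1 - q) * (cabs u / t) ^+ k.
  move=> hx; rewrite cabsM cabsX expr_div_n mulrCA mulrC.
  apply: ler_wpM2l; first by rewrite exprn_ge0 ?cabs_ge0.
  by rewrite ler_pdivlMr // exprn_gt0.
have hd k := bnd _ k (shift_coef_le k).
have := csum_cvg qu hd; suff -> : csum (fun k => shift_coef c a k * u ^+ k) =
  csum (fun n => c n * (a + u) ^+ n) by [].
apply/esym/csumE.
pose v N k := series (fun m => 'C(m + k, k)%:R * c (m + k)%N * a ^+ m)
                     (N - k)%N * u ^+ k.
have -> : series (fun n => c n * (a + u) ^+ n) = (fun N => series (v N) N).
  by apply/funext => N; rewrite -partial_sum_reexpansion.
apply: (tannery qu) => [N k|k].
  apply: bnd; rewrite -ler_pdivlMr ?exprn_gt0 // [A / _ / _]mulrAC.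
  have := geometric_series_tail hq (fun m => term_le m k) (leq0n (N - k)%N).
  by rewrite {2}/series /= big_geq // subr0 expr0 mulr1.
apply: cvgMr_tmp; exact: cvg_subn (@shift_coef_cvg k).
Qed.

End Reexpansion.

Definition ps_on f a c r : Prop := forall z, cabs (z - a) < r ->
  series (fun k => c k * (z - a) ^+ k) @ \oo --> f z.

Lemma ps_on_coef_bounded f a c r s : ps_on f a c r -> 0 < s < r ->
  exists A, forall k, cabs (c k) * s ^+ k <= A.
Proof.
move=> h /andP[s0 sr].
have as_r : cabs (a + s%:C - a) < r by rewrite addrC addKr cabs_real // ltW.
have /cvgP/cvg_series_cvg_0/cvgcP/(_ 1 ltr01)[N hN] := h _ as_r.
have hk k : cabs (c k * (a + s%:C - a) ^+ k - 0) = cabs (c k) * s ^+ k.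
  by rewrite subr0 cabsM cabsX addrC addKr cabs_real // ltW.
exists (1 + \sum_(0 <= k < N) cabs (c k) * s ^+ k) => k.
have t0 j : 0 <= cabs (c j) * s ^+ j.
  by rewrite mulr_ge0 ?cabs_ge0 ?exprn_ge0 // ltW.
case: (leqP N k) => [Nk|kN].
  rewrite -hk; apply: le_trans (ltW (hN k Nk)) _.
  by rewrite lerDl sumr_ge0.
rewrite big_mkord (bigD1 (Ordinal kN)) //= addrCA lerDl addr_ge0 //.
by apply: sumr_ge0.
Qed.

Lemma ps_on_csum f a c r z : ps_on f a c r -> cabs (z - a) < r ->
  csum (fun k => c k * (z - a) ^+ k) = f z.
Proof. by move=> h hz; apply: csumE; apply: h. Qed.

Lemma ps_on_center f a c r : 0 < r -> ps_on f a c r -> f a = c 0.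
Proof.
move=> r0 /(_ a); rewrite subrr cabs0 => /(_ r0) h.
apply: (cvgc_unique h); apply/cvgcP => e e0; exists 1%N => -[|n] // _.
rewrite /series /= big_mkord big_ord_recl expr0 mulr1.
rewrite big1 => [|k _]; first by rewrite addr0 subrr cabs0.
by rewrite expr0n mulr0.
Qed.

Lemma ps_on_widen f a c r s : s <= r -> ps_on f a c r -> ps_on f a c s.
Proof. by move=> sr h z hz; apply: h; apply: lt_le_trans sr. Qed.

Lemma ps_on_shift f a c r b : ps_on f a c r -> cabs (b - a) < r ->
  ps_on f b (shift_coef c (b - a)) (r - cabs (b - a)).
Proof.
move=> h hb z hz.
(* A third of the available margin, to leave room for the radii [t] and [s] of
   the re-expansion strictly between [|z - b|] and [r]. *)
pose d := (r - cabs (b - a) - cabs (z - b)) / 3.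
have d0 : 0 < d by rewrite divr_gt0 // subr_gt0.
have hd : d * 3 = r - cabs (b - a) - cabs (z - b) by rewrite /d; lra.
have b0 := cabs_ge0 (b - a); have z0 := cabs_ge0 (z - b).
pose t := cabs (z - b) + d; pose s := cabs (b - a) + t + d.
have [|A hA] := @ps_on_coef_bounded _ _ _ _ s h.
  by rewrite /s /t; apply/andP; split; lra.
have := @reexpansion c A s (b - a) t hA _ _ (z - b).
have -> : b - a + (z - b) = z - a by rewrite addrC addrA subrK.
rewrite (ps_on_csum h); last by have := cabs_tri b z a; lra.
by apply; rewrite /s /t; lra.
Qed.

(** The geometric bound on the coefficients makes the series without its first
    two terms quadratically small at the centre. *)
Lemma ps_on_derive1 f a c r : 0 < r -> ps_on f a c r -> (derive1 f) a = c 1%N.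
Proof.
move=> r0 h; apply: cvg_lim; first exact: norm_hausdorff.
have [|A hA] := @ps_on_coef_bounded _ _ _ _ (r / 2) h.
  by apply/andP; split; lra.
have A0 : 0 <= A.
  by have := hA 0; rewrite expr0 mulr1; apply: le_trans (cabs_ge0 _).
set s := r / 2 in hA; have s0 : 0 < s by rewrite divr_gt0.
apply/cvgrPdist_le => e e0.
have eR : e = (complex.Re e)%:C by rewrite RRe_real // gtr0_real.
set e' := complex.Re e in eR; have e'0 : 0 < e' by rewrite -ltcR -eR.
pose d := Num.min (s / 2) (e' * s ^+ 2 / (2 * A + 1)).
have s20 : 0 < s ^+ 2 by rewrite exprn_gt0.
have A1 : 0 < 2 * A + 1 by lra.
have d0 : 0 < d by rewrite lt_min !divr_gt0 ?mulr_gt0.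
exists d%:C; first by rewrite /= ltcR.
move=> y /=; rewrite sub0r normrN cabsE ltcR => yd y0.
rewrite eR cabsE lecR.
have cy0 : 0 < cabs y by rewrite lt_def cabs_ge0 cabs_eq0 y0.
have ys : cabs y < s / 2 by apply: lt_le_trans yd _; rewrite ge_min lexx.
have yA : cabs y * (2 * A + 1) <= e' * s ^+ 2.
  rewrite -ler_pdivlMr //; apply: le_trans (ltW yd) _.
  by rewrite ge_min lexx orbT.
have hq : 0 <= cabs y / s < 1.
  by rewrite divr_ge0 ?cabs_ge0 ?(ltW s0) //= ltr_pdivrMr // mul1r; lra.
have hdom k : cabs (c k * y ^+ k) <= A * (cabs y / s) ^+ k.
  rewrite cabsM cabsX expr_div_n mulrCA mulrC.
  apply: ler_wpM2l; first by rewrite exprn_ge0 ?cabs_ge0.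
  by rewrite ler_pdivlMr // exprn_gt0.
have fy : csum (fun k => c k * y ^+ k) = f (y + a).
  have := @ps_on_csum f a c r (y + a) h; rewrite addrK; apply.
  by rewrite /s in ys; lra.
have := csum_tail 2 hq hdom.
rewrite fy /series /= big_nat_recr //= big_nat1 expr0 expr1 mulr1.
rewrite -(ps_on_center r0 h) => hle.
have -> : c 1%N - y^-1 *: (f (y + a) - f a) =
    - (y^-1 * (f (y + a) - (f a + c 1%N * y))).
  rewrite /GRing.scale /=; field.
  exact: y0.
rewrite cabsN cabsM cabsV ler_pdivrMl //.
apply: le_trans hle _.
rewrite ler_pdivrMr; last by case/andP: hq => _; rewrite subr_gt0.
have q2 : 1 / 2 <= 1 - cabs y / s.
  have : cabs y / s <= 1 / 2 by rewrite ler_pdivrMr //; lra.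
  lra.
apply: (@le_trans _ _ (cabs y * e' * (1 / 2))); last first.
  by apply: ler_wpM2l => //; rewrite mulr_ge0 // ltW.
rewrite expr_div_n mulrA ler_pdivrMr //.
have : cabs y * (cabs y * (2 * A + 1)) <= cabs y * (e' * s ^+ 2).
  by apply: ler_wpM2l => //; exact: ltW.
have : 0 <= cabs y * cabs y by rewrite mulr_ge0 // ltW.
rewrite !expr2; lra.
Qed.

(** The derivative at [z] is the linear coefficient of the expansion at [z]. *)
Lemma ps_on_derive f a c r : ps_on f a c r ->
  ps_on (derive1 f) a (fun k => k.+1%:R * c k.+1) r.
Proof.
move=> h z hz.
have -> : (derive1 f) z = shift_coef c (z - a) 1.
  by apply: (ps_on_derive1 _ (ps_on_shift h hz)); rewrite subr_gt0.
pose d := (r - cabs (z - a)) / 3.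
have hd : d * 3 = r - cabs (z - a) by rewrite /d; lra.
have d0 : 0 < d by rewrite divr_gt0 // subr_gt0.
have z0 := cabs_ge0 (z - a).
have [|A hA] := @ps_on_coef_bounded _ _ _ _ (cabs (z - a) + d + d) h.
  by apply/andP; split; lra.
have := @shift_coef_cvg c A (cabs (z - a) + d + d) (z - a) d hA d0 _ 1.
rewrite (_ : (fun m => _) = (fun k => k.+1%:R * c k.+1 * (z - a) ^+ k)).
  by apply; lra.
by apply/funext => m; rewrite addn1 bin1.
Qed.

Lemma ps_on_derive1n f a c r j : ps_on f a c r ->
  ps_on (derive1n j f) a (fun k => ((k + j)`!%:R / k`!%:R) * c (k + j)%N) r.
Proof.
move=> h; elim: j => [|j IH].
  rewrite derive1n0 (_ : (fun k => _) = c) //; apply/funext => k.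
  by rewrite addn0 divff ?mul1r // pnatr_eq0 -lt0n fact_gt0.
rewrite derive1nS (_ : (fun k => _) =
  (fun k => k.+1%:R * (((k.+1 + j)`!%:R / k.+1`!%:R) * c (k.+1 + j)%N))).
  exact: (ps_on_derive IH).
apply/funext => k; rewrite addnS addSn [k.+1`!]factS natrM.
have k1 : k.+1%:R != 0 :> C by rewrite pnatr_eq0.
have canc (p x y z : C) : p != 0 -> x * y * z = p * (x * (p^-1 * y) * z).
  by move=> p0; field.
by rewrite invfM; exact: canc.
Qed.

Definition taylor f a (k : nat) : C := derive1n k f a / k`!%:R.

(** The coefficients are read off from the derivatives at the centre, so that
    two expansions of the same function at the same point agree. *)
Lemma ps_on_taylor f a c r : 0 < r -> ps_on f a c r -> taylor f a = c.
Proof.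
move=> r0 h; apply/funext => k.
rewrite /taylor (ps_on_center r0 (@ps_on_derive1n f a c r k h)) add0n fact0 divr1.
by rewrite mulrAC mulfV ?mul1r // pnatr_eq0 -lt0n fact_gt0.
Qed.

Lemma taylor_shift f a c r b : ps_on f a c r -> cabs (b - a) < r ->
  taylor f b = shift_coef c (b - a).
Proof.
move=> h hb; apply: (ps_on_taylor _ (ps_on_shift h hb)).
by rewrite subr_gt0.
Qed.

End PowerSeries.

(** * Cauchy estimates and uniform bounds on a compact disk *)

Section Cauchy.
Variable R : realType.
Local Notation C := (Cplx R).
Implicit Types (c : nat -> C) (a b z : C) (f : C -> C) (A q r s t : R).

Lemma prim_root_exists (F : numClosedFieldType) n : (0 < n)%N ->
  exists w : F, n.-primitive_root w.
Proof.
move=> n0; have [rs] := closed_field_poly_normal ('X^n - 1 : {poly F}).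
rewrite (monicP (monicXnsubC _ n0)) scale1r => Drs.
have hn : (n <= size rs)%N.
  by rewrite -ltnS -(size_prod_XsubC rs id) -Drs size_XnsubC.
have hroot : all n.-unity_root rs.
  by apply/allP => w; rewrite -root_prod_XsubC -Drs.
have huniq : uniq rs.
  by rewrite -separable_prod_XsubC -Drs separable_Xn_sub_1 // pnatr_eq0 -lt0n.
by have /hasP[w _ hw] := has_prim_root n0 hroot huniq hn; exists w.
Qed.

(** The average of [p (r w^i) / w^(m i)] over the [N]-th roots of unity [w^i] is
    [c m * r ^+ m], as no other index below [N] is congruent to [m]. *)
Lemma cauchy_polynomial c (N m : nat) r (B : R) : 0 <= r -> (m < N)%N ->
  (forall z, cabs z = r -> cabs (series (fun k => c k * z ^+ k) N) <= B) ->
  cabs (c m) * r ^+ m <= B.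
Proof.
move=> r0 mN hB; have N0 : (0 < N)%N by apply: leq_ltn_trans mN.
have [w hw] := prim_root_exists C N0.
have w0 : w != 0.
  apply/eqP => w0; have := prim_expr_order hw; rewrite w0 expr0n gtn_eqF //.
  by move=> /eqP; rewrite eq_sym oner_eq0.
have cw i : cabs (w ^+ i) = 1.
  have : cabs w ^+ N = 1 by rewrite -cabsX (prim_expr_order hw) cabs1.
  by move=> /eqP; rewrite cabsX pexpr_eq1 ?cabs_ge0 // => /eqP ->; rewrite expr1n.
pose p z := series (fun k => c k * z ^+ k) N.
have orth k : (k < N)%N ->
    \sum_(i < N) (w ^+ k / w ^+ m) ^+ i = if k == m then N%:R else 0.
  move=> kN; set x := w ^+ k / w ^+ m.
  have xN : x ^+ N = 1.
    by rewrite expr_div_n -!exprM ![(_ * N)%N]mulnC !exprM (prim_expr_order hw)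
      !expr1n divr1.
  have [km|km] := eqVneq k m.
    rewrite /x km (eq_bigr (fun=> 1)).
      by rewrite sumr_const card_ord.
    by move=> i _; rewrite divff ?expf_neq0 // expr1n.
  have x1 : x != 1.
    apply: contra km => /eqP x1; have /eqP : w ^+ k = w ^+ m.
      by rewrite -[w ^+ m]mul1r -x1 /x divfK // expf_neq0.
    by rewrite (eq_prim_root_expr hw) !modn_small.
  apply/eqP; have : (x - 1) * \sum_(i < N) x ^+ i = 0.
    by rewrite -subrX1 xN subrr.
  by move=> /eqP; rewrite mulf_eq0 subr_eq0 (negPf x1).
have avg : \sum_(i < N) p (r%:C * w ^+ i) / (w ^+ m) ^+ i =
    N%:R * (c m * r%:C ^+ m).
  transitivity (\sum_(k < N) c k * r%:C ^+ k *
      \sum_(i < N) (w ^+ k / w ^+ m) ^+ i).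
    rewrite /p /series /=.
    under eq_bigr => i _ do rewrite big_mkord mulr_suml.
    rewrite exchange_big /=; apply: eq_bigr => k _.
    rewrite mulr_sumr; apply: eq_bigr => i _.
    rewrite exprMn expr_div_n -!exprM [(i * k)%N]mulnC; ring.
  rewrite (bigD1 (Ordinal mN)) //= orth // eqxx mulrC big1 ?addr0 // => k km.
  rewrite orth //; case: eqP => [ekm|_]; last by rewrite mulr0.
  by case/eqP: km; apply: val_inj.
have NR : 0 < N%:R :> R by rewrite ltr0n.
rewrite -(ler_pM2l NR).
have -> : N%:R * (cabs (c m) * r ^+ m) = cabs (N%:R * (c m * r%:C ^+ m)).
  by rewrite !cabsM cabs_nat cabsX cabs_real.
rewrite -avg; apply: le_trans (cabs_sum _ _ _) _.
apply: le_trans (_ : \sum_(i < N) B <= _); last first.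
  by rewrite sumr_const card_ord mulr_natl.
apply: ler_sum => i _; rewrite cabsM cabsV -exprM cw invr1 mulr1.
by apply: hB; rewrite cabsM cw mulr1 cabs_real.
Qed.

(** A long enough partial sum has the same coefficient [c m] and is uniformly
    close to [f] on the circle. *)
Lemma cauchy_estimate f c r s (B : R) m : 0 < s < r -> ps_on f 0 c r ->
  (forall z, cabs z = s -> cabs (f z) <= B) -> cabs (c m) * s ^+ m <= B.
Proof.
move=> /andP[s0 sr] h hB.
have [|A hA] := @ps_on_coef_bounded _ _ _ _ _ ((s + r) / 2) h.
  by apply/andP; split; lra.
set t := (s + r) / 2 in hA; have t0 : 0 < t by rewrite /t; lra.
have hq : 0 <= s / t < 1.
  by rewrite divr_ge0 ?ltW //= ltr_pdivrMr // mul1r /t; lra.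
have hdom z k : cabs z = s -> cabs (c k * z ^+ k) <= A * (s / t) ^+ k.
  move=> zs; rewrite cabsM cabsX expr_div_n zs mulrCA mulrC.
  apply: ler_wpM2l; first by rewrite exprn_ge0 ?ltW.
  by rewrite ler_pdivlMr // exprn_gt0.
apply/ler_addgt0Pr => e e0.
have [N hN] := geometric_small (A / (1 - s / t)) hq e0.
have Nm : (N <= maxn N m.+1)%N by rewrite leq_maxl.
apply: (@cauchy_polynomial c (maxn N m.+1) m); rewrite ?(ltW s0) ?leq_maxr //.
move=> z zs; set K := maxn _ _ in Nm *.
have h1 := csum_tail K hq (fun k => hdom z k zs).
have h2 := hN K Nm; rewrite mulrAC in h2.
have h3 : csum (fun k => c k * z ^+ k) = f z.
  have := @ps_on_csum _ f 0 c r z h; rewrite subr0 zs; exact.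
have h4 := cabs_tri (f z) (series (fun k => c k * z ^+ k) K) 0.
have h5 := hB z zs.
rewrite h3 cabsB in h1; rewrite !subr0 in h4; lra.
Qed.

(** One parameter controls both the radius of convergence and the size of the
    coefficients, so that a compactness argument only has to enlarge [D]. *)
Definition taylor_bound f a (D : R) : Prop :=
  ps_on f a (taylor f a) D^-1 /\ forall k, cabs (taylor f a k) <= D ^+ k.+1.

(** The expansion at [a], valid on radius [r], is re-expanded at the points [b]
    with [|b - a| < r / 4], where it converges on radius [r / 4] at least. *)
Lemma taylor_bound_near f a : analytic_at f a ->
  exists d D0 : R, [/\ 0 < d, 0 < D0 & forall b D,
    cabs (b - a) < d -> D0 <= D -> taylor_bound f b D].
Proof.
move=> [c [r r0 hc]].
have {}hc : ps_on f a c r by move=> z hz; apply: hc; rewrite cabsE ltcR.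
have [|A hA] := @ps_on_coef_bounded _ _ _ _ _ (3 / 4 * r) hc.
  by apply/andP; split; lra.
have A0 : 0 <= A.
  by have := hA 0; rewrite expr0 mulr1; apply: le_trans (cabs_ge0 _).
have r4 : 0 < 4 / r by rewrite divr_gt0.
exists (r / 4), (4 / r + 3 * A); split; [by rewrite divr_gt0|lra|].
move=> b D hb hD; have b0 := cabs_ge0 (b - a).
have D0 : 0 < D by lra.
have rD : 4 / r <= D by lra.
have DV : D^-1 <= r / 4 by rewrite -[r / 4]invrK invf_div lef_pV2 ?posrE.
have hbr : cabs (b - a) < r by lra.
split.
  rewrite (taylor_shift hc hbr).
  by apply: ps_on_widen (ps_on_shift hc hbr); lra.
move=> k; rewrite (taylor_shift hc hbr).
have := @shift_coef_le _ c A (3 / 4 * r) (b - a) (r / 4) hA _ _ k.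
set x := shift_coef _ _ _ => hx.
have {hx} : cabs x * (r / 4) ^+ k <= 3 * A.
  apply: le_trans (hx _ _) _; [lra|lra|].
  (* Half of [r] against [3 / 4 * r]: the ratio [2 / 3] is the origin of the
     factor 3 in the bound. *)
  set y := (cabs (b - a) + r / 4) / (3 / 4 * r).
  have hy : y <= 2 / 3 by rewrite ler_pdivrMr; lra.
  rewrite ler_pdivrMr; last by lra.
  have : 0 <= A * (2 / 3 - y) by rewrite mulr_ge0 // subr_ge0.
  lra.
rewrite -ler_pdivlMr ?exprn_gt0 ?divr_gt0 // => /le_trans; apply.
rewrite -exprVn invf_div exprS; apply: ler_pM => //.
- by rewrite mulr_ge0.
- by rewrite exprn_ge0 // ltW.
- lra.
- by apply: lerXn2r; rewrite // nnegrE ltW.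
Qed.

(** Compactness is obtained in the plane [R * R], as a closed part of a square. *)
Lemma compact_disk (rho : R) :
  compact [set p : R * R | cabs (p.1 +i* p.2 : C) <= rho].
Proof.
pose sq := `[- rho, rho]%classic : set R.
apply: (@subclosed_compact _ _ (sq `*` sq)).
- have -> : [set p : R * R | cabs (p.1 +i* p.2 : C) <= rho] =
      (fun p : R * R => cabs (p.1 +i* p.2 : C)) @^-1` [set x | x <= rho].
    by [].
  apply: preimage_closed; last exact: closed_le.
  move=> p _; rewrite /cabs.
  have -> : (fun p : R * R => complex.Re `|p.1 +i* p.2 : C|) =
     Num.sqrt \o (fun p => p.1 * p.1 + p.2 * p.2).
    by apply/funext => x; rewrite normc_def.
  apply: continuous_comp; last exact: sqrt_continuous.
  by apply: cvgD; apply: cvgM; (exact: cvg_fst || exact: cvg_snd).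
- by apply: compact_setX; exact: segment_compact.
- move=> p /= hp; rewrite /sq /= !in_itv /= -!ler_norml; split.
    exact: le_trans (cabs_Re (p.1 +i* p.2)) hp.
  exact: le_trans (cabs_Im (p.1 +i* p.2)) hp.
Qed.
End Cauchy.

(** * Continuation of a Taylor series up to the boundary of a disk *)

Section Continuation.
Variable R : realType.
Local Notation C := (Cplx R).
Implicit Types (c : nat -> C) (a b z : C) (f : C -> C) (A q r s t : R).

(** Around each point of the disk, [taylor_bound f _ D] holds for all large [D] on
    a neighbourhood; a compact set needs finitely many of these. *)
Lemma taylor_bound_uniform f (rho : R) :
  (forall a, cabs a <= rho -> analytic_at f a) ->
  exists2 D : R, 0 < D & forall a, cabs a <= rho -> taylor_bound f a D.
Proof.
move=> hf; pose tb (i : nat) (p : R * R) :=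
  taylor_bound f (p.1 +i* p.2) i%:R.
have /compact_near_coveringP/(_ nat \oo tb) := @compact_disk R rho.
case=> [p /= hp|N _ hN].
  have [d [D0 [d0 D00 hd]]] := taylor_bound_near (hf _ hp).
  exists (ball p.1 (d / 2) `*` ball p.2 (d / 2), [set i | (Num.bound D0 <= i)%N]).
    split=> /=; last by exists (Num.bound D0).
    exists (ball p.1 (d / 2), ball p.2 (d / 2)) => //.
    by split; apply: nbhsx_ballx; rewrite divr_gt0.
  move=> [p' i] /= [[h1 h2] hi]; apply: hd.
    apply: le_lt_trans (cabs_ReIm _) _ => /=.
    rewrite [`|_ - p.1|]distrC [`|_ - p.2|]distrC [d]splitr.
    exact: ltrD.
  apply: le_trans (ltW (archi_boundP (ltW D00))) _.
  by rewrite ler_nat.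
exists N.+1%:R => // a ha; have := hN N.+1 (leqnSn N) (complex.Re a, complex.Im a).
by rewrite /tb /=; case: a ha => x y /= ha; apply.
Qed.

(** Cauchy's estimates for [f^(k) / k!] on the circle of radius [s] bound the
    products ['C(n, k) * |c n| * s ^+ (n - k)]; weighted by [(2 * D)^-1 ^+ k],
    these are the binomial terms of the left-hand side. *)
Lemma taylor_coef_bound f (rho D r s : R) n : 0 < D ->
  (forall a, cabs a <= rho -> taylor_bound f a D) ->
  0 < s < r -> s <= rho -> ps_on f 0 (taylor f 0) r ->
  cabs (taylor f 0 n) * (s + (2 * D)^-1) ^+ n <= 2 * D.
Proof.
move=> D0 hD hs srho h; have /andP[s0 sr] := hs.
set c := taylor f 0 in h *.
have D20 : 0 < 2 * D by lra.
have est k : (k <= n)%N -> 'C(n, k)%:R * cabs (c n) * s ^+ (n - k) <= D ^+ k.+1.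
  move=> kn; have fk : 0 < k`!%:R :> R by rewrite ltr0n fact_gt0.
  have hz z : cabs z = s -> cabs (derive1n k f z) <= D ^+ k.+1 * k`!%:R.
    move=> zs; have [|_ /(_ k)] := hD z; first by rewrite zs.
    by rewrite /taylor cabsM cabsV cabs_nat ler_pdivrMr.
  have := cauchy_estimate (n - k) hs (@ps_on_derive1n _ f 0 c r k h) hz.
  rewrite subnK // -ler_pdivrMr // !cabsM cabsV !cabs_nat.
  apply: le_trans; rewrite le_eqVlt; apply/orP; left; apply/eqP.
  have -> : 'C(n, k)%:R = n`!%:R / (n - k)`!%:R / k`!%:R :> R.
    rewrite -(bin_fact kn) !natrM; field.
    by rewrite !pnatr_eq0 -!lt0n !fact_gt0.
  ring.
rewrite exprDn mulr_sumr.
apply: (@le_trans _ _ (\sum_(k < n.+1) D * (1 / 2) ^+ k)).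
  apply: ler_sum => k _.
  have kn : (k <= n)%N by rewrite -ltnS.
  have -> : cabs (c n) * (s ^+ (n - k) * (2 * D)^-1 ^+ k *+ 'C(n, k)) =
     'C(n, k)%:R * cabs (c n) * s ^+ (n - k) / (2 * D) ^+ k.
    by rewrite -mulr_natl exprVn; ring.
  rewrite ler_pdivrMr ?exprn_gt0 //; apply: le_trans (est k kn) _.
  rewrite -mulrA -exprMn mulrA div1r mulVf ?pnatr_eq0 // mul1r.
  by rewrite exprS.
rewrite -(big_mkord predT (fun k => D * (1 / 2) ^+ k)).
rewrite -[leLHS]/(series (geometric D (1 / 2)) n.+1) geometric_seriesE; last by lra.
have := exprn_ge0 n.+1 (_ : 0 <= 1 / 2 :> R).
move=> /(_ ltac:(lra)) h0; have : 0 <= D * (1 / 2) ^+ n.+1.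
  by rewrite mulr_ge0 // ltW.
by rewrite /= ler_pdivrMr; lra.
Qed.

(** A point [z] of the new annulus is within reach of the expansion of [f] at the
    point [a] of modulus [s < r] on the segment from 0 to [z]; since [f] is the sum
    of its Taylor series near [a], that expansion is the re-expansion of the
    series at 0, which is summable at [z] by [taylor_coef_bound]. *)
Lemma ps_on_extend f (rho D r : R) : 0 < D ->
  (forall a, cabs a <= rho -> taylor_bound f a D) ->
  0 < r <= rho -> ps_on f 0 (taylor f 0) r ->
  ps_on f 0 (taylor f 0) (r + (4 * D)^-1).
Proof.
move=> D0 hD /andP[r0 rrho] h z; rewrite subr0 => hz.
have [zr|rz] := ltP (cabs z) r; first by have := h z; rewrite subr0; apply.
have D4 : 0 < (4 * D)^-1 by rewrite invr_gt0; lra.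
have D2 : (2 * D)^-1 = 2 * (4 * D)^-1 by field; rewrite gt_eqF.
have D1 : D^-1 = 4 * (4 * D)^-1 by field; rewrite gt_eqF.
set e := (4 * D)^-1 in hz D4 D2 D1.
(* Positive, and close enough to [r] for [s + 2 * e] to reach [r + e]. *)
pose s := Num.max (r / 2) (r - e).
have s0 : 0 < s by rewrite lt_max; apply/orP; left; lra.
have sr : s < r by rewrite gt_max; apply/andP; split; lra.
have se : r - e <= s by rewrite le_max lexx orbT.
have hc n : cabs (taylor f 0 n) * (s + 2 * e) ^+ n <= 2 * D.
  rewrite -D2; apply: (taylor_coef_bound _ _ hD _ _ h) => //.
    by rewrite s0 sr.
  by lra.
have z0 : 0 < cabs z by lra.
have zn0 : z != 0 by rewrite -cabs_eq0 gt_eqF.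
pose a := (s / cabs z)%:C * z.
have cz : cabs a = s.
  by rewrite cabsM cabs_real ?divr_ge0 ?(ltW s0) ?(ltW z0) // divfK // gt_eqF.
have hza : cabs (z - a) = cabs z - s.
  have -> : z - a = (1 - s / cabs z)%:C * z by rewrite rmorphB rmorph1 mulrBl mul1r.
  rewrite cabsM cabs_real; last by rewrite subr_ge0 ler_pdivrMr // mul1r; lra.
  by rewrite mulrBl mul1r divfK // gt_eqF.
have ha0 : cabs (a - 0) < r by rewrite subr0 cz.
have [|hps _] := hD a; first by rewrite cz; lra.
have hfz := hps z; rewrite (taylor_shift h ha0) subr0 in hfz.
have {}hfz := hfz ltac:(rewrite hza; lra).
have hq : 0 <= cabs z / (s + 2 * e) < 1.
  rewrite divr_ge0 ?(ltW z0) //=; last by lra.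
  by rewrite ltr_pdivrMr; lra.
have := @reexpansion _ (taylor f 0) (2 * D) (s + 2 * e) a
  ((cabs z - s + 2 * e) / 2) hc _ _ (z - a).
rewrite cz hza addrCA subrr addr0 => hre.
have {}hre := hre ltac:(lra) ltac:(lra) ltac:(lra).
rewrite (cvgc_unique hfz hre).
apply: (@csum_cvg _ _ (2 * D) _ hq) => k.
rewrite cabsM cabsX expr_div_n mulrCA mulrC.
apply: ler_wpM2l; first by rewrite exprn_ge0 ?cabs_ge0.
by rewrite ler_pdivlMr // exprn_gt0 //; lra.
Qed.

(** Every extension gains the same amount [(4 * D)^-1], so the radius passes [rho]
    after finitely many of them. *)
Theorem taylor_series_of_analytic f (rho : R) : 0 <= rho ->
  (forall a, cabs a <= rho -> analytic_at f a) ->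
  exists2 r, rho < r & ps_on f 0 (taylor f 0) r.
Proof.
move=> rho0 hf; have [D D0 hD] := taylor_bound_uniform hf.
pose e := (4 * D)^-1; have e0 : 0 < e by rewrite invr_gt0; lra.
have DV : 0 < D^-1 by rewrite invr_gt0.
have steps N : (exists2 r, rho < r & ps_on f 0 (taylor f 0) r) \/
    ps_on f 0 (taylor f 0) (D^-1 + N%:R * e).
  elim: N => [|N [?|IH]]; [right|by left|].
    by rewrite mul0r addr0; have [|] := hD 0; rewrite ?cabs0.
  have [hr|hr] := ltP rho (D^-1 + N%:R * e).
    by left; exists (D^-1 + N%:R * e).
  right; rewrite -natr1 mulrDl mul1r addrA.
  apply: (ps_on_extend D0 hD _ IH); rewrite hr andbT.
  by rewrite ltr_wpDr // mulr_ge0 // ltW.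
have [N hN] : exists N, rho < N%:R * e.
  exists (Num.bound (rho / e)); rewrite -ltr_pdivrMr //.
  by apply: archi_boundP; rewrite divr_ge0 // ltW.
have [//|h] := steps N; exists (D^-1 + N%:R * e) => //; lra.
Qed.

End Continuation.

(** * The infinite matrix and its eigenvectors *)

Section Matrices.
Variable R : realType.
Local Notation C := (Cplx R).

Lemma cvg_cvP n (u : nat -> 'cV[C]_n) (l : 'cV[C]_n) :
  u @ \oo --> l <-> forall i, (fun m => u m i 0) @ \oo --> l i 0.
Proof.
split=> [h i A hA|h A [P hP PA]].
  by apply: (h [set v | A (v i 0)]); exact: (@coord_continuous C n 1 i 0 l A hA).
have : \forall m \near \oo, forall i, P i 0 (u m i 0).
  by apply: filter_forall => i; apply: (h i); exact: hP.
by apply: filterS => m hm; apply: (PA (u m)) => i j; rewrite (ord1 j).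
Qed.

Lemma series_cv n (u : nat -> 'cV[C]_n) i m :
  series u m i 0 = series (fun j => u j i 0) m.
Proof. by rewrite /series /= summxE. Qed.

Lemma conjmx_mul m n p (A : 'M[C]_(m, n)) (B : 'M[C]_(n, p)) :
  (A *m B)^t* = B^t* *m A^t*.
Proof. by rewrite trmx_mul map_mxM. Qed.

Lemma conjmx_scale_nat m n (k : nat) (A : 'M[C]_(m, n)) :
  (k%:R *: A)^t* = k%:R *: A^t*.
Proof. by apply/matrixP => i j; rewrite !mxE rmorphM rmorph_nat. Qed.

Lemma conjmxN m n (A : 'M[C]_(m, n)) : (- A)^t* = - A^t*.
Proof. by apply/matrixP => i j; rewrite !mxE rmorphN. Qed.

Lemma cabs_conj (x : C) : cabs (Num.conj x) = cabs x.
Proof. by rewrite /cabs norm_conjC. Qed.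

Lemma csum_recl (u : nat -> C) (l : C) : series u @ \oo --> l ->
  series (fun j => u j.+1) @ \oo --> l - u 0%N.
Proof.
move=> /cvgcP h; apply/cvgcP => e e0; have [N hN] := h e e0.
exists N => m Nm; have := hN m.+1 (leqW Nm).
suff -> : series u m.+1 - l = series (fun j => u j.+1) m - (l - u 0%N) by [].
by rewrite /series /= big_nat_recl //; ring.
Qed.

Lemma norm2_ge0 n (v : 'cV[C]_n) : 0 <= norm2 v.
Proof. exact: sqrtr_ge0. Qed.

Lemma cabs_sqr (z : C) : cabs z ^+ 2 = complex.Re z ^+ 2 + complex.Im z ^+ 2.
Proof. by rewrite /cabs normc_def /= sqr_sqrtr // addr_ge0 ?sqr_ge0. Qed.

Lemma cabs_le_norm2 n (v : 'cV[C]_n) i : cabs (v i 0) <= norm2 v.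
Proof.
rewrite -(@ler_pXn2r _ 2) ?nnegrE ?cabs_ge0 ?norm2_ge0 // cabs_sqr.
have h j : 0 <= complex.Re (v j 0) ^+ 2 + complex.Im (v j 0) ^+ 2.
  by rewrite addr_ge0 ?sqr_ge0.
rewrite sqr_sqrtr ?sumr_ge0 // (bigD1 i) //= lerDl sumr_ge0 //.
Qed.

Lemma norm2_le_sum n (v : 'cV[C]_n) : norm2 v <= \sum_i cabs (v i 0).
Proof.
have s0 (r : seq 'I_n) : 0 <= \sum_(i <- r) cabs (v i 0).
  by apply: sumr_ge0 => i _; exact: cabs_ge0.
rewrite -(@ler_pXn2r _ 2) ?nnegrE ?norm2_ge0 //.
have h (r : seq 'I_n) : 0 <=
    \sum_(i <- r) (complex.Re (v i 0) ^+ 2 + complex.Im (v i 0) ^+ 2).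
  by apply: sumr_ge0 => i _; rewrite addr_ge0 ?sqr_ge0.
rewrite sqr_sqrtr //; elim: (index_enum _) => [|i r IH].
  by rewrite !big_nil expr0n.
rewrite !big_cons -cabs_sqr sqrrD.
have := mulr_ge0 (cabs_ge0 (v i 0)) (s0 r); lra.
Qed.

Variables (n : nat) (M : C -> 'M[C]_n).
Implicit Types (y z : 'cV[C]_n) (w : blocks R n).

Definition taylor_mx (m : nat) : 'M[C]_n :=
  \matrix_(i, k) taylor (fun x => M x i k) 0 m.

Lemma mx_deriveE m : mx_derive M m 0 = m`!%:R *: taylor_mx m.
Proof.
by apply/matrixP => i k; rewrite !mxE /taylor mulrC divfK.
Qed.

Lemma iter_STI w j k :
  iter j (@STI R n) w k = (k`!%:R / (k + j)`!%:R) *: w (k + j)%N.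
Proof.
elim: j k => [|j IH] k.
  by rewrite addn0 divff ?scale1r // pnatr_eq0 -lt0n fact_gt0.
rewrite iterS {1}/STI IH scalerA addSnnS; congr (_ *: _).
by rewrite factS natrM !mulrA mulVf ?mul1r // pnatr_eq0.
Qed.

Section Dual.
Hypothesis hM0 : M 0 \in unitmx.

Lemma conj_unitmx_surj z : exists y, z = (M 0)^t* *m y.
Proof.
exists ((invmx (M 0))^t* *m z).
by rewrite mulmxA -conjmx_mul mulVmx // trmx1 map_mx1 mul1mx.
Qed.

Lemma conj_unitmx_inj y : (M 0)^t* *m y = 0 -> y = 0.
Proof.
move=> h; have := congr1 (mulmx ((invmx (M 0))^t*)) h.
by rewrite mulmxA -conjmx_mul mulmxV // trmx1 map_mx1 mul1mx mulmx0.
Qed.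

Definition dual_coef y m : 'cV[C]_n := (taylor_mx m)^t* *m y.

(** The choice [z = M(0)^* y] cancels the factor [M(0)^-1] of the blocks of [N]. *)
Lemma Nstar_dual y k :
  Nstar M ((M 0)^t* *m y) k = - (k`!%:R *: dual_coef y k.+1).
Proof.
rewrite /Nstar /Nmx mx_deriveE -scalemxAr scalerA factS natrM mulKf ?pnatr_eq0 //.
rewrite conjmxN conjmx_scale_nat conjmx_mul mulNmx -scalemxAl -mulmxA.
have inv1 : (invmx (M 0))^t* *m (M 0)^t* = 1%:M.
  by rewrite -conjmx_mul mulmxV // trmx1 map_mx1.
by rewrite (mulmxA ((invmx (M 0))^t*)) inv1 mul1mx.
Qed.

Lemma NstarZ a z k : Nstar M (a *: z) k = a *: Nstar M z k.
Proof. by rewrite /Nstar -scalemxAr. Qed.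

Variables (rho s A : R) (lambda : C).
Hypotheses (hC : forall i k m, cabs (taylor_mx m i k) * s ^+ m <= A)
  (hM : forall i k, ps_on (fun x => M x i k) 0 (fun m => taylor_mx m i k) s)
  (A0 : 0 <= A) (rho0 : 0 < rho) (rho_s : rho < s) (lam0 : lambda != 0)
  (lam_rho : cabs lambda < rho).

Let s0 : 0 < s.
Proof. exact: lt_trans rho0 rho_s. Qed.

Let q := cabs lambda / s.

Let hq : 0 <= q < 1.
Proof.
rewrite divr_ge0 ?cabs_ge0 ?(ltW s0) //= ltr_pdivrMr // mul1r.
exact: lt_trans rho_s.
Qed.

Let B y := A * \sum_i cabs (y i 0).

Lemma dual_coef_le y m i : cabs (dual_coef y m i 0) * s ^+ m <= B y.
Proof.
rewrite mxE /B mulr_sumr; apply: le_trans (ler_wpM2r _ (cabs_sum _ _ _)) _.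
  by rewrite exprn_ge0 // ltW.
rewrite mulr_suml; apply: ler_sum => k _.
rewrite cabsM !mxE cabs_conj mulrAC; apply: ler_wpM2r; first exact: cabs_ge0.
by have := hC k i m; rewrite mxE.
Qed.

Definition dual_tail y k i : C :=
  csum (fun j => lambda ^+ j.+1 * dual_coef y (k + j).+1 i 0).

Let tail_le y k i j : cabs (lambda ^+ j.+1 * dual_coef y (k + j).+1 i 0) <=
  cabs lambda * B y / s ^+ k.+1 * q ^+ j.
Proof.
have -> : cabs lambda * B y / s ^+ k.+1 * q ^+ j =
  cabs lambda ^+ j.+1 * (B y / s ^+ (k + j).+1).
  by rewrite /q expr_div_n -addSn exprD [_ ^+ j.+1]exprS invfM; ring.
rewrite cabsM cabsX; apply: ler_wpM2l; first by rewrite exprn_ge0 ?cabs_ge0.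
by rewrite ler_pdivlMr ?exprn_gt0 // dual_coef_le.
Qed.

Lemma dual_tail_cvg y k i :
  series (fun j => lambda ^+ j.+1 * dual_coef y (k + j).+1 i 0) @ \oo -->
  dual_tail y k i.
Proof. exact: csum_cvg hq (tail_le y k i). Qed.

Lemma dual_tail_le y k i : cabs (dual_tail y k i) <=
  cabs lambda * B y / (1 - q) / s ^+ k.+1.
Proof. by rewrite mulrAC; exact: csum_le hq (tail_le y k i). Qed.

Lemma dual_tail_rec y k i : dual_tail y k i =
  lambda * (dual_coef y k.+1 i 0 + dual_tail y k.+1 i).
Proof.
have h := csum_recl (@dual_tail_cvg y k i).
have h' : series (fun j => lambda ^+ j.+2 * dual_coef y (k + j.+1).+1 i 0)
    @ \oo --> lambda * dual_tail y k.+1 i.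
  have -> : series (fun j => lambda ^+ j.+2 * dual_coef y (k + j.+1).+1 i 0) =
    (fun N => lambda * series (fun j =>
                lambda ^+ j.+1 * dual_coef y (k.+1 + j).+1 i 0) N).
    apply/funext => N; rewrite /series /= mulr_sumr; apply: eq_bigr => j _.
    by rewrite exprS -mulrA addnS addSn.
  by apply: cvgMl_tmp; exact: dual_tail_cvg.
have := cvgc_unique h h'; rewrite expr1 addn0 mulrDr => <-.
by rewrite addrC subrK.
Qed.

(** The sum of the series of the theorem for [z = M(0)^* y]. *)
Definition dual_blocks y : blocks R n :=
  fun k => \col_i (- (k`!%:R * dual_tail y k i)).

Lemma dual_blocks_of0 k : dual_blocks 0 k = 0.
Proof.
apply/matrixP => i j; rewrite !mxE /dual_tail (_ : (fun j => _) = cst 0).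
  rewrite (@csumE _ _ 0) ?mulr0 ?oppr0 // (_ : series _ = cst 0).
    exact: cvg_cst.
  by apply/funext => N; rewrite /series /= big1.
by apply/funext => m; rewrite /dual_coef mulmx0 mxE mulr0.
Qed.

Lemma left_seriesE y w : left_series M lambda ((M 0)^t* *m y) w <->
  forall k, w k = dual_blocks y k.
Proof.
have hcv k : series (fun j => iter j (@STI R n)
    (Nstar M (lambda ^+ j.+1 *: ((M 0)^t* *m y))) k) @ \oo --> dual_blocks y k.
  apply/cvg_cvP => i; rewrite mxE.
  rewrite (_ : (fun m => _) = (fun N => - (k`!%:R * series (fun j =>
      lambda ^+ j.+1 * dual_coef y (k + j).+1 i 0) N))).
    by apply: cvgN; apply: cvgMl_tmp; exact: dual_tail_cvg.
  apply/funext => N; rewrite series_cv /series /= mulr_sumr -sumrN.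
  apply: eq_bigr => j _.
  rewrite iter_STI NstarZ Nstar_dual mxE [X in _ * X]mxE [X in _ * (_ * X)]mxE.
  rewrite [X in _ * (_ * - X)]mxE !mulrN; congr (- _).
  rewrite [_ ^+ _ * (_ * _)]mulrCA [LHS]mulrA divfK //.
split=> [h k|h k]; last by rewrite h.
apply/matrixP => i j; rewrite (ord1 j).
exact: (cvgc_unique ((cvg_cvP _ _).1 (h k) i) ((cvg_cvP _ _).1 (hcv k) i)).
Qed.

(** Splitting off the first term of each block. *)
Lemma dual_blocks_rec y k : dual_blocks y k =
  lambda *: (Nstar M ((M 0)^t* *m y) k + STI (dual_blocks y) k).
Proof.
apply/matrixP => i j; rewrite (ord1 j) Nstar_dual.
transitivity (lambda * (- (k`!%:R * dual_coef y k.+1 i 0) +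
    k.+1%:R^-1 * - (k.+1`!%:R * dual_tail y k.+1 i))); last by rewrite !mxE.
rewrite [LHS]mxE dual_tail_rec factS natrM.
have k1 : k.+1%:R != 0 :> C by rewrite pnatr_eq0.
by rewrite -[k.+1%:R * _ * _]mulrA mulrN mulKf //; ring.
Qed.

(** Up to sign, block 0 is the Taylor series of [x |-> M x], adjoint and at the
    conjugate of [lambda], without its constant term [(M 0)^t* *m y]. *)
Lemma dual_blocks0 y :
  dual_blocks y 0 = (M 0)^t* *m y - (M (Num.conj lambda))^t* *m y.
Proof.
apply/matrixP => i j; rewrite (ord1 j) mxE fact0 mul1r [RHS]mxE [X in _ + X]mxE.
have hMl : series (fun m => lambda ^+ m * dual_coef y m i 0) @ \oo -->
    ((M (Num.conj lambda))^t* *m y) i 0.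
  rewrite mxE (_ : series _ = (fun N => \sum_l
      Num.conj (series (fun m => taylor_mx m l i * (Num.conj lambda - 0) ^+ m) N)
        * y l 0)).
    apply: cvgc_sum => l; apply: cvgMr_tmp; rewrite !mxE.
    have hl : cabs (Num.conj lambda - 0) < s.
      by rewrite subr0 cabs_conj; exact: lt_trans rho_s.
    have /cvgcP h := @hM l i (Num.conj lambda) hl; apply/cvgcP => e e0.
    have [N hN] := h e e0; exists N => m Nm.
    by rewrite -rmorphB cabs_conj; exact: hN.
  apply/funext => N; rewrite /series /=.
  rewrite (eq_bigr (fun m =>
    \sum_l lambda ^+ m * (Num.conj (taylor_mx m l i) * y l 0))).
    rewrite exchange_big /=; apply: eq_bigr => l _.
    rewrite rmorph_sum mulr_suml; apply: eq_bigr => m _.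
    rewrite subr0 rmorphM rmorphXn /= conjCK.
    by rewrite mulrCA mulrA.
  move=> m _; rewrite mxE mulr_sumr; apply: eq_bigr => l _.
  by rewrite !mxE.
have := cvgc_unique (csum_recl hMl) (@dual_tail_cvg y 0 i) => <-.
have -> : dual_coef y 0 = (M 0)^t* *m y.
  congr (_^t* *m _); apply/matrixP => k l.
  by rewrite (ps_on_center s0 (@hM k l)).
by rewrite expr0 mul1r opprB.
Qed.

(** The factor [k!] of the blocks cancels in the weights of [ell_1(rho)], which
    leaves a series dominated by the powers of [rho / s < 1]. *)
Lemma dual_blocks_in_ell1 y : in_ell1 rho (dual_blocks y).
Proof.
have hr : 0 <= rho / s < 1.
  by rewrite divr_ge0 ?(ltW s0) ?(ltW rho0) //= ltr_pdivrMr // mul1r.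
apply: (@cvgn_geometric_dominated _ _
  (rho / s * (n%:R * (cabs lambda * B y / (1 - q)))) _ hr) => k.
have fk : 0 < k`!%:R :> R by rewrite ltr0n fact_gt0.
have fk1 : 0 < k.+1`!%:R :> R by rewrite ltr0n fact_gt0.
rewrite ger0_norm; last first.
  by rewrite mulr_ge0 ?norm2_ge0 // divr_ge0 ?exprn_ge0 // ltW.
have hn : norm2 (dual_blocks y k) <=
    n%:R * (k`!%:R * (cabs lambda * B y / (1 - q) / s ^+ k.+1)).
  apply: le_trans (norm2_le_sum _) _.
  rewrite -[n in leRHS]card_ord mulr_natl -sumr_const; apply: ler_sum => i _.
  rewrite mxE cabsN cabsM cabs_nat ler_pM2l //; exact: dual_tail_le.
have h0 : 0 <= rho ^+ k.+1 / (k.+1)`!%:R.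
  by rewrite divr_ge0 ?exprn_ge0 // ltW.
apply: le_trans (ler_wpM2l h0 hn) _.
set X := cabs lambda * B y / (1 - q).
have X0 : 0 <= X.
  have q1 : 0 < 1 - q by rewrite subr_gt0; case/andP: hq.
  rewrite divr_ge0 ?mulr_ge0 ?cabs_ge0 ?(ltW q1) //.
  by apply: sumr_ge0 => i _; exact: cabs_ge0.
have -> : rho / s * (n%:R * X) * (rho / s) ^+ k =
    n%:R * X * (rho ^+ k.+1 / s ^+ k.+1).
  by rewrite -expr_div_n exprS; ring.
rewrite factS natrM.
have -> : rho ^+ k.+1 / (k.+1%:R * k`!%:R) * (n%:R * (k`!%:R * (X / s ^+ k.+1))) =
   n%:R * X * (rho ^+ k.+1 / s ^+ k.+1) / k.+1%:R.
  have alg (r S F K N : R) : F != 0 -> K != 0 -> S != 0 ->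
      r / (K * F) * (N * (F * (X / S))) = N * X * (r / S) / K.
    by move=> F1 K1 S1; field; rewrite F1 K1 S1.
  by apply: alg; [rewrite gt_eqF|rewrite pnatr_eq0|rewrite gt_eqF ?exprn_gt0].
rewrite ler_pdivrMr ?ltr0n // ler_peMr ?ler1n //.
by apply: mulr_ge0; [exact: mulr_ge0|rewrite divr_ge0 ?exprn_ge0 // ltW].
Qed.

(** Each of the [J + 1] powers [p ^+ i], [i <= J], is at least [p ^+ J], and
    [1 - p] times their sum is at most 1. *)
Lemma mul_geometric_le (p : R) J : 0 <= p <= 1 ->
  (1 - p) * (J.+1%:R * p ^+ J) <= 1.
Proof.
move=> /andP[p0 p1].
suff : (1 - p) * (J.+1%:R * p ^+ J) <= 1 - p ^+ J.+1.
  by move/le_trans; apply; rewrite lerBlDr lerDl exprn_ge0.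
elim: J => [|J IH]; first by rewrite expr0 expr1 !mulr1.
have h := ler_wpM2l p0 IH.
have hX : 0 <= (1 - p) * (1 - p ^+ J.+1).
  by rewrite mulr_ge0 ?subr_ge0 // exprn_ile1.
rewrite -natr1 [p ^+ J.+2]exprS; move: h hX; rewrite exprS; nra.
Qed.

(** The eigenvalue equation, solved for [w] and iterated [J] times, gives [J] terms
    of the series and the remainder [lambda ^+ J *: iter J STI w].  In block [k] the
    latter is a null sequence (the terms of the series defining [ell_1(rho)]) times
    [(k + J + 1) (|lambda| / rho) ^ J], up to a constant. *)
Lemma eigen_left_series w :
  eigenpair_Astar rho M lambda^-1 w -> left_series M lambda (w 0%N) w.
Proof.
move=> [hell _ heig].
have hrec k : w k = lambda *: (Nstar M (w 0%N) k + STI w k).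
  by rewrite -/(Astar M w k) heig scalerA divff // scale1r.
have expand k J : w k =
    series (fun j => iter j (@STI R n) (Nstar M (lambda ^+ j.+1 *: w 0%N)) k) J
    + lambda ^+ J *: iter J (@STI R n) w k.
  elim: J => [|J IH]; first by rewrite /series /= big_geq // add0r scale1r.
  rewrite seriesSr -addrA {1}IH; congr (_ + _).
  rewrite !iter_STI {1}hrec NstarZ /STI addnS factS natrM.
  rewrite !scalerDr !scalerA; congr (_ *: _ + _ *: _); rewrite ?exprSr.
    by ring.
  by rewrite invfM; ring.
set b := fun m => rho ^+ m.+1 / (m.+1)`!%:R * norm2 (w m) in hell.
have b0 : b @ \oo --> (0 : R) by apply: cvg_series_cvg_0.
pose p := cabs lambda / rho.
have p0 : 0 <= p by rewrite divr_ge0 ?cabs_ge0 // ltW.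
have p1 : p < 1 by rewrite ltr_pdivrMr // mul1r.
have q1 : 0 < 1 - p by rewrite subr_gt0.
move=> k; apply/cvg_cvP => i; apply/cvgcP => e e0.
pose W := (k%:R + 1 / (1 - p)) * (k`!%:R / rho ^+ k.+1).
have W0 : 0 < W.
  rewrite mulr_gt0 ?divr_gt0 ?exprn_gt0 ?ltr0n ?fact_gt0 //.
  by rewrite ltr_wpDl // divr_gt0.
have [N hN] := cvgR0P b0 (divr_gt0 e0 W0).
exists N => J NJ; rewrite cabsB {1}(expand k J) [X in X - _]mxE addrAC subrr add0r.
rewrite iter_STI !mxE !cabsM cabsV cabsX !cabs_nat.
have := hN (k + J)%N (leq_trans NJ (leq_addl _ _)).
rewrite ltr_pdivlMr //; apply: le_lt_trans.
apply: (@le_trans _ _ (cabs lambda ^+ J *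
  (k`!%:R / (k + J)`!%:R * norm2 (w (k + J)%N)))).
  apply: ler_wpM2l; first by rewrite exprn_ge0 ?cabs_ge0.
  by apply: ler_wpM2l; [rewrite divr_ge0|exact: cabs_le_norm2].
have -> : cabs lambda ^+ J * (k`!%:R / (k + J)`!%:R * norm2 (w (k + J)%N)) =
    b (k + J)%N * ((k + J).+1%:R * p ^+ J * (k`!%:R / rho ^+ k.+1)).
  rewrite /b /p expr_div_n factS natrM -addSn exprD.
  have alg (L rJ rk F K G V : R) : rJ != 0 -> rk != 0 -> F != 0 -> K != 0 ->
      L * (G / F * V) = rk * rJ / (K * F) * V * (K * (L / rJ) * (G / rk)).
    by move=> h1 h2 h3 h4; field; rewrite h1 h2 h3 h4.
  by apply: alg; [rewrite gt_eqF ?exprn_gt0|rewrite gt_eqF ?exprn_gt0|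
    rewrite gt_eqF ?ltr0n ?fact_gt0|rewrite pnatr_eq0].
apply: ler_wpM2l.
  by rewrite mulr_ge0 ?norm2_ge0 // divr_ge0 ?exprn_ge0 // ltW.
apply: ler_wpM2r; first by rewrite divr_ge0 ?exprn_ge0 // ltW.
rewrite -addnS natrD mulrDl lerD //.
  by rewrite ler_piMr // exprn_ile1 // ltW.
rewrite ler_pdivlMr // mulrC; apply: mul_geometric_le.
by rewrite p0 ltW.
Qed.

(** Since [dual_blocks y] solves the same recursion with [N^* z] instead of
    [N^* w_0], only [N^* (z - w_0)] stands in the way of an eigenvector. *)
Lemma dual_blocks_eigenP y :
  (forall k, Astar M (dual_blocks y) k = lambda^-1 *: dual_blocks y k) <->
  (forall k, Nstar M ((M (Num.conj lambda))^t* *m y) k = 0).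
Proof.
have NB z z' k : Nstar M (z - z') k = Nstar M z k - Nstar M z' k.
  by rewrite /Nstar mulmxBr.
have rec k : lambda^-1 *: dual_blocks y k =
    Nstar M ((M 0)^t* *m y) k + STI (dual_blocks y) k.
  by rewrite [in LHS]dual_blocks_rec scalerA mulVf // scale1r.
split=> h k.
  have := h k; rewrite rec /Astar dual_blocks0 NB => /addIr /eqP.
  by rewrite -subr_eq0 addrAC subrr add0r oppr_eq0 => /eqP.
by rewrite rec /Astar dual_blocks0 NB h subr0.
Qed.

End Dual.

End Matrices.

(** * The theorem *)

(** There are finitely many entries, so a common radius beyond [rho] exists. *)
Lemma taylor_mx_bound (R : realType) (n : nat) (M : Cplx R -> 'M[Cplx R]_n)
    (rho : R) : 0 < rho -> analytic_on_closed_disk rho M ->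
  exists s A : R, [/\ rho < s, 0 <= A,
    forall i k m, cabs (taylor_mx M m i k) * s ^+ m <= A &
    forall i k, ps_on (fun x => M x i k) 0 (fun m => taylor_mx M m i k) s].
Proof.
move=> rho0 hM.
have entry (ik : 'I_n * 'I_n) : exists2 r, rho < r &
    ps_on (fun x => M x ik.1 ik.2) 0 (fun m => taylor_mx M m ik.1 ik.2) r.
  have [|r rhor hr] :=
      @taylor_series_of_analytic R (fun x => M x ik.1 ik.2) rho (ltW rho0).
    by move=> a ha; apply: hM; rewrite cabsE lecR.
  exists r => //; rewrite (_ : (fun m => _) = taylor (fun x => M x ik.1 ik.2) 0) //.
  by apply/funext => m; rewrite mxE.
have near_r ik : \forall s \near rho^'+, exists2 r, s < r &
    ps_on (fun x => M x ik.1 ik.2) 0 (fun m => taylor_mx M m ik.1 ik.2) r.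
  have [r rhor hr] := entry ik.
  by apply: filterS (nbhs_right_lt rhor) => s sr; exists r.
have [s [rhos hs]] :=
  filter_ex (filterI (nbhs_right_gt rho) (filter_forall _ near_r)).
have s0 : 0 < s by exact: lt_trans rhos.
have /choice[A hA] : forall ik : 'I_n * 'I_n, exists A : R, forall m,
    cabs (taylor_mx M m ik.1 ik.2) * s ^+ m <= A.
  move=> ik; have [r sr hr] := hs ik.
  by apply: (@ps_on_coef_bounded _ _ _ _ _ s hr); rewrite s0.
exists s, (\sum_ik `|A ik|); split=> //.
- by apply: sumr_ge0.
- move=> i k m; apply: le_trans (hA (i, k) m) _.
  apply: le_trans (ler_norm _) _; rewrite (bigD1 (i, k)) //= lerDl.
  by apply: sumr_ge0.
- by move=> i k; have [r sr hr] := hs (i, k); apply: ps_on_widen (ltW sr) hr.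
Qed.

Theorem theorem2p2 (R : realType) (rho : R) (n : nat)
    (M : Cplx R -> 'M[Cplx R]_n)
    (hrho : 0 < rho)
    (hM : analytic_on_closed_disk rho M)
    (hM0 : M 0 \in unitmx) :
  (forall (mu : Cplx R) (w : blocks R n),
      mu != 0 -> `|mu^-1| < rho%:C -> eigenpair_Astar rho M mu w ->
      exists z : 'cV[Cplx R]_n, left_series M mu^-1 z w)
  /\
  (forall lambda : Cplx R, lambda != 0 -> `|lambda| < rho%:C ->
    [/\ forall y : 'cV[Cplx R]_n,
          exists w : blocks R n, left_series M lambda ((M 0)^t* *m y) w,
        forall w : blocks R n,
          eigenpair_Astar rho M lambda^-1 w <->
          exists y : 'cV[Cplx R]_n,
            [/\ y != 0, dual_solution M lambda y
              & left_series M lambda ((M 0)^t* *m y) w]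
      & (forall v : 'cV[Cplx R]_n,
            (forall j, (0 < j)%N -> (Nmx M j)^t* *m v = 0) -> v = 0) ->
        forall (y : 'cV[Cplx R]_n) (w : blocks R n), y != 0 ->
          left_series M lambda ((M 0)^t* *m y) w ->
          (dual_solution M lambda y <-> eigenpair_Astar rho M lambda^-1 w)]).
Proof.
have [s [A [rhos A0 hA hps]]] := taylor_mx_bound hrho hM.
split=> [mu w mu0 hmu heig|lambda lam0].
  exists (w 0%N); apply: (@eigen_left_series _ _ _ rho) => //.
  - by rewrite invr_eq0.
  - by rewrite -ltcR -cabsE.
  - by rewrite invrK.
rewrite cabsE ltcR => lam_rho.
have seriesE := left_seriesE hM0 hA hrho rhos lam_rho.
have blocks0 := dual_blocks0 hA hps hrho rhos lam_rho.
have eigenP := dual_blocks_eigenP hM0 hA hps hrho rhos lam0 lam_rho.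
have extend y w : left_series M lambda ((M 0)^t* *m y) w ->
    w = dual_blocks M lambda y by move=> /seriesE h; apply/funext.
have dual_eigen y : y != 0 -> dual_solution M lambda y ->
    eigenpair_Astar rho M lambda^-1 (dual_blocks M lambda y).
  move=> y0 hy; have {}hy : (M (Num.conj lambda))^t* *m y = 0 := hy.
  split; first exact: (dual_blocks_in_ell1 hA A0 hrho rhos lam_rho).
    exists 0%N; rewrite blocks0 hy subr0; apply: contra y0 => /eqP h.
    by apply/eqP; exact: (conj_unitmx_inj hM0 h).
  by apply/eigenP => k; rewrite hy /Nstar mulmx0.
split=> [y|w|inj y w y0 /extend ->].
- by exists (dual_blocks M lambda y); apply/seriesE.
- split=> [heig|[y [y0 hy /extend ->]]]; last exact: dual_eigen.
  have [y hy] := conj_unitmx_surj hM0 (w 0%N).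
  have hw := eigen_left_series hrho lam0 lam_rho heig; rewrite hy in hw.
  have we := extend y w hw; exists y; split=> //.
    apply/eqP => y0; case: heig => _ [k /eqP wk] _; apply: wk.
    by rewrite we y0 dual_blocks_of0.
  have := blocks0 y; rewrite -we hy => /eqP.
  by rewrite eq_sym subr_eq addrC -subr_eq subrr eq_sym => /eqP.
split=> [|[_ _ /eigenP h]]; first exact: dual_eigen.
by apply: inj => -[//|j] _; exact: h.
Qed.
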